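(* There exist absolute constants $c>0$ and $C>0$ such that the following holds. For every integer $n\ge1$ and all parameters $0<\varepsilon_2\le 1$ and $0\le \varepsilon_1\le c\,\varepsilon_2$, there is a tester which, given \[ m\le C\left( n\Big(\frac{\varepsilon_1}{\varepsilon_2^2}\Big)^2+n\,\frac{\varepsilon_1}{\varepsilon_2^2}+\frac{\sqrt n}{\varepsilon_2^{2}} +\frac{n^{2/3}}{\varepsilon_2^{4/3}} \right) \] independent samples from each of two unknown distributions $p$ and $q$ over $[n]$, distinguishes between $\|p-q\|_1\le \varepsilon_1$ and $\|p-q\|_1\ge \varepsilon_2$ with probability at least $4/5$.
   Context: $[n]=\{1,\dots,n\}$; distributions over $[n]$ are probability vectors; $\|p-q\|_1=\sum_i|p_i-q_i|$. ''Distinguishes with probability at least $4/5$'' means: outputs ''close'' with probability $\ge4/5$ whenever $\|p-q\|_1\le\varepsilon_1$ and ''far'' with probability $\ge 4/5$ whenever $\|p-q\|_1\ge\varepsilon_2$. *)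

(* Defs.v *)
From HB Require Import structures.
From mathcomp Require Import all_boot all_order all_algebra.
From mathcomp Require Import all_classical all_reals all_analysis.
Set Implicit Arguments. Unset Strict Implicit. Unset Printing Implicit Defensive.
Import Order.TTheory GRing.Theory Num.Theory.
Local Open Scope ring_scope.

Definition is_dist (R : realType) (n : nat) (p : {ffun 'I_n -> R}) : Prop :=
  (forall i, 0 <= p i) /\ \sum_(i < n) p i = 1.

Definition l1dist (R : realType) (n : nat) (p q : {ffun 'I_n -> R}) : R :=
  \sum_(i < n) `|p i - q i|.

Definition sample_prob (R : realType) (n m : nat) (p : {ffun 'I_n -> R})
  (s : m.-tuple 'I_n) : R := \prod_(k < m) p (tnth s k).

(* A (possibly randomized) tester using m samples from each of p and q:
   T s t is the probability that it outputs "close" on samples s (from p)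
   and t (from q). *)
Definition is_tester (R : realType) (n m : nat)
  (T : m.-tuple 'I_n -> m.-tuple 'I_n -> R) : Prop :=
  forall s t, 0 <= T s t <= 1.

Definition accept_prob (R : realType) (n m : nat)
  (T : m.-tuple 'I_n -> m.-tuple 'I_n -> R) (p q : {ffun 'I_n -> R}) : R :=
  \sum_(s : m.-tuple 'I_n) \sum_(t : m.-tuple 'I_n)
     sample_prob p s * sample_prob q t * T s t.

(* Main.v *)
(* Let X_i, X'_i and Y_i, Y'_i be the numbers of occurrences of i in two batches
   of k samples from p and two from q. The statistic
     Z = sum_i sum_(t < k) (1[X_i > t] - 1[Y_i > t]) (1[X'_i > t] - 1[Y'_i > t])
   has expectation sum_i sum_t (P(X_i > t) - P(Y_i > t))^2. Replacing the
   Bernoulli(p_i) summands of X_i by Bernoulli(q_i) one at a time shows that this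
   is at most k |p - q|_1, and, by Chebyshev's inequality and Cauchy-Schwarz, that
   it is at least (k |p - q|_1)^2 / (24 sqrt(n k) + 8 k |p - q|_1 + 20 n). Changing
   one sample moves Z by at most 8, so by the Efron-Stein argument Z has variance
   O(k), and thresholding Z works as soon as the two expectation bounds are
   separated by a multiple of sqrt k. *)
Require Import Defs.
From HB Require Import structures.
From mathcomp Require Import all_boot all_order all_algebra.
From mathcomp Require Import all_classical all_reals all_analysis.
From mathcomp Require Import ring lra zify.
Import Order.TTheory GRing.Theory Num.Theory.
Local Open Scope ring_scope.

(** * Expectation over independent samples *)

Definition prob_vec {R : realType} {I : finType} (d : I -> R) : Prop :=
  (forall i, 0 <= d i) /\ \sum_i d i = 1.

(** Each position carries its own distribution, so the samples from both unknown distributions form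
    a single list. *)
Fixpoint expect {R : realType} {I : finType} (ds : seq (I -> R))
    (f : seq I -> R) : R :=
  if ds is d :: ds' then \sum_i d i * expect ds' (fun s => f (i :: s))
  else f [::].

Section Expectation.
Context {R : realType} {I : finType}.
Implicit Types (ds : seq (I -> R)) (f g : seq I -> R).

Lemma eq_expect ds f g : (forall s, size s = size ds -> f s = g s) ->
  expect ds f = expect ds g.
Proof.
elim: ds f g => [|d ds IH] f g fg /=; first exact: fg.
by apply: eq_bigr => i _; congr (_ * _); apply: IH => s sz; apply: fg; rewrite /= sz.
Qed.

Lemma expectD ds f g :
  expect ds (fun s => f s + g s) = expect ds f + expect ds g.
Proof.
elim: ds f g => [|d ds IH] f g //=; rewrite -big_split /=.
by apply: eq_bigr => i _; rewrite IH mulrDr.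
Qed.

Lemma expectZ ds (a : R) f : expect ds (fun s => a * f s) = a * expect ds f.
Proof.
elim: ds f => [|d ds IH] f //=; rewrite mulr_sumr.
by apply: eq_bigr => i _; rewrite IH mulrCA.
Qed.

Lemma expectB ds f g :
  expect ds (fun s => f s - g s) = expect ds f - expect ds g.
Proof.
rewrite expectD -[in RHS]mulN1r -expectZ; congr (_ + _).
by apply: eq_expect => s _; rewrite mulN1r.
Qed.

Lemma expectZr ds (a : R) f : expect ds (fun s => f s * a) = expect ds f * a.
Proof. by rewrite mulrC -expectZ; apply: eq_expect => s _; rewrite mulrC. Qed.

Lemma expect_sum ds (J : Type) (r : seq J) (F : J -> seq I -> R) :
  expect ds (fun s => \sum_(j <- r) F j s) = \sum_(j <- r) expect ds (F j).
Proof.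
elim: r => [|j r IH].
  under eq_expect => s _ do rewrite big_nil -(mul0r 0).
  by rewrite expectZ mul0r big_nil.
by under eq_expect => s _ do rewrite big_cons; rewrite expectD IH big_cons.
Qed.

Lemma expect_cat ds1 ds2 f :
  expect (ds1 ++ ds2) f = expect ds1 (fun s1 => expect ds2 (fun s2 => f (s1 ++ s2))).
Proof. by elim: ds1 f => [|d ds IH] f //=; apply: eq_bigr => i _; rewrite IH. Qed.

Lemma expect_cst ds (a : R) : {in ds, forall d, prob_vec d} ->
  expect ds (fun=> a) = a.
Proof.
elim: ds => [|d ds IH] //= dsP; rewrite -mulr_suml IH.
  by rewrite (proj2 (dsP d (mem_head _ _))) mul1r.
by move=> e eds; apply: dsP; rewrite in_cons eds orbT.
Qed.

Lemma le_expect ds f g : {in ds, forall d, prob_vec d} ->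
  (forall s, size s = size ds -> f s <= g s) -> expect ds f <= expect ds g.
Proof.
elim: ds f g => [|d ds IH] f g /= dsP fg; first exact: fg.
apply: ler_sum => i _; apply: ler_wpM2l; first by case: (dsP d (mem_head _ _)).
apply: IH => [e eds|s sz]; first by apply: dsP; rewrite in_cons eds orbT.
by apply: fg; rewrite /= sz.
Qed.

Lemma expect_sqr_shift ds f (x : R) : {in ds, forall d, prob_vec d} ->
  expect ds (fun s => (f s - x) ^+ 2) =
  expect ds (fun s => (f s - expect ds f) ^+ 2) + (expect ds f - x) ^+ 2.
Proof.
move=> dsP; set e := expect ds f.
under eq_expect => s _.
  rewrite (_ : _ ^+ 2 = (f s - e) ^+ 2 + (2 * (e - x) * (f s - e) + (e - x) ^+ 2)).
  over.
  by ring.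
by rewrite 2!expectD expectZ expectB !expect_cst// subrr mulr0 add0r.
Qed.

(** Efron-Stein by conditioning on the first sample: the variance is the mean of the conditional
    variances, bounded by induction, plus the variance of the conditional means [e i], which
    pairwise differ by at most [c]. *)
Lemma expect_bounded_diff ds f (c : R) : {in ds, forall d, prob_vec d} ->
  (forall s1 x y s2, `|f (s1 ++ x :: s2) - f (s1 ++ y :: s2)| <= c) ->
  expect ds (fun s => (f s - expect ds f) ^+ 2) <= (size ds)%:R * c ^+ 2.
Proof.
elim: ds f => [|d ds IH] f dsP fP /=; first by rewrite subrr expr0n mul0r.
have dP : prob_vec d by apply: dsP; exact: mem_head.
have {}dsP : {in ds, forall d, prob_vec d}.
  by move=> e eds; apply: dsP; rewrite in_cons eds orbT.
set e := fun i => expect ds (fun s => f (i :: s)); set a := \sum_i d i * e i.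
have ediff i j : `|e i - e j| <= c.
  rewrite /e -expectB ler_norml; apply/andP; split.
    rewrite -[leLHS](@expect_cst ds)//; apply: le_expect => // s _.
    by have := fP [::] i j s; rewrite ler_norml => /andP[].
  rewrite -[leRHS](@expect_cst ds)//; apply: le_expect => // s _.
  by have := fP [::] i j s; rewrite ler_norml => /andP[].
have ea i : (e i - a) ^+ 2 <= c ^+ 2.
  have c0 : 0 <= c by apply: le_trans (ediff i i).
  rewrite -[leLHS]real_normK ?num_real// ler_sqr ?nnegrE//.
  have -> : e i - a = \sum_j d j * (e i - e j).
    rewrite -[e i in LHS]mul1r -(proj2 dP) mulr_suml -sumrB.
    by apply: eq_bigr => j _; rewrite mulrBr.
  apply: le_trans (ler_norm_sum _ _ _) _.
  rewrite -[leRHS]mul1r -(proj2 dP) mulr_suml; apply: ler_sum => j _.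
  by rewrite normrM ger0_norm ?(proj1 dP)// ler_wpM2l ?(proj1 dP) ?ediff.
have -> : (size ds).+1%:R * c ^+ 2 =
    \sum_i d i * ((size ds)%:R * c ^+ 2 + c ^+ 2).
  by rewrite -mulr_suml (proj2 dP) mul1r -natr1 mulrDl mul1r.
apply: ler_sum => i _; apply: ler_wpM2l; first exact: (proj1 dP).
rewrite expect_sqr_shift//; apply: lerD; last exact: ea.
by apply: IH => // s1 x y s2; exact: (fP (i :: s1)).
Qed.

(** Chebyshev: where [f s] exceeds [b], its deviation exceeds [g], so the indicator dominates one
    minus the squared ratio of deviation to [g]. *)
Lemma expect_le_ind_ge ds f (v b g : R) : {in ds, forall d, prob_vec d} -> 0 < g ->
  expect ds (fun s => (f s - expect ds f) ^+ 2) <= v ->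
  expect ds f <= b - g ->
  1 - v / g ^+ 2 <= expect ds (fun s => (f s <= b)%R%:R).
Proof.
move=> dsP g0 fv fb; have g20 : 0 < g ^+ 2 by rewrite exprn_gt0.
apply: (@le_trans _ _ (expect ds (fun s => 1 - (f s - expect ds f) ^+ 2 / g ^+ 2))).
  by rewrite expectB expectZr expect_cst// lerD2l lerN2 ler_pM2r ?invr_gt0.
apply: le_expect => // s _; have [_|fsb] := leP (f s) b.
  by rewrite mulr1n gerBl divr_ge0 ?sqr_ge0.
rewrite mulr0n subr_le0 ler_pdivlMr// mul1r ler_sqr ?nnegrE; lra.
Qed.

Lemma expect_le_ind_le ds f (v b g : R) : {in ds, forall d, prob_vec d} -> 0 < g ->
  expect ds (fun s => (f s - expect ds f) ^+ 2) <= v ->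
  b + g <= expect ds f ->
  expect ds (fun s => (f s <= b)%R%:R) <= v / g ^+ 2.
Proof.
move=> dsP g0 fv fb; have g20 : 0 < g ^+ 2 by rewrite exprn_gt0.
apply: (@le_trans _ _ (expect ds (fun s => (f s - expect ds f) ^+ 2 / g ^+ 2))).
  apply: le_expect => // s _; have [fsb|_] := leP (f s) b.
    by rewrite ler_pdivlMr// mul1r -[leRHS]sqrrN ler_sqr ?nnegrE; lra.
  by rewrite divr_ge0 ?sqr_ge0.
by rewrite expectZr ler_pM2r ?invr_gt0.
Qed.

End Expectation.

(** Passes from the tuple sums of [accept_prob] to [expect], where induction on the samples is
    available. *)
Lemma sum_sample_prob (R : realType) (n m : nat) (p : {ffun 'I_n -> R})
    (f : seq 'I_n -> R) :
  \sum_(s : m.-tuple 'I_n) sample_prob p s * f s =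
  expect (nseq m (p : 'I_n -> R)) f.
Proof.
elim: m f => [|m IH] f /=.
  rewrite (big_pred1 [tuple]) => [|s]; first by rewrite /sample_prob big_ord0 mul1r.
  by rewrite [s]tuple0 /= eqxx.
under [RHS]eq_bigr => i _ do rewrite -IH mulr_sumr.
rewrite pair_bigA/=.
rewrite (reindex (fun u : 'I_n * m.-tuple 'I_n => [tuple of u.1 :: u.2])) /=.
  apply: eq_bigr => -[i s] _ /=; rewrite /sample_prob big_ord_recl /= mulrA.
  congr (_ * _ * _); apply: eq_bigr => j _; congr (p _).
  by rewrite !(tnth_nth i).
exists (fun s : m.+1.-tuple 'I_n => (thead s, [tuple of behead s])) => [[i s] _|s _] /=.
  by congr pair; apply: val_inj.
by rewrite [RHS]tuple_eta; apply: val_inj.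
Qed.

(** * Sums of Bernoulli variables *)

(** Cauchy-Schwarz, one index at a time: the new cross term [2 * (a j * x)] is at most
    [l j * z + y * b j] by AM-GM, proved in squared form. *)
Lemma sqr_sum_le {R : realType} (J : finType) (a l b : J -> R) :
  (forall j, 0 <= l j) -> (forall j, 0 <= b j) ->
  (forall j, a j ^+ 2 <= l j * b j) ->
  (\sum_j a j) ^+ 2 <= (\sum_j l j) * \sum_j b j.
Proof.
move=> l0 b0 alb; suff: [/\ 0 <= \sum_j l j, 0 <= \sum_j b j &
  (\sum_j a j) ^+ 2 <= (\sum_j l j) * \sum_j b j] by case.
apply: (big_rec3 (fun x y z => [/\ 0 <= y, 0 <= z & x ^+ 2 <= y * z])).
  by rewrite mulr0 expr0n.
move=> j x y z _ [y0 z0 xyz]; split; [exact: addr_ge0|exact: addr_ge0|].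
have ly : 0 <= l j * z + y * b j by rewrite addr_ge0 ?mulr_ge0.
have : (2 * (a j * x)) ^+ 2 <= (l j * z + y * b j) ^+ 2.
  apply: (@le_trans _ _ (4 * ((l j * b j) * (y * z)))).
    rewrite (_ : (2 * _) ^+ 2 = 4 * (a j ^+ 2 * x ^+ 2)); last by ring.
    by rewrite ler_pM2l// ler_pM ?sqr_ge0.
  have := sqr_ge0 (l j * z - y * b j); lra.
rewrite -[leLHS]real_normK ?num_real// ler_sqr ?nnegrE// => /(le_trans (ler_norm _)).
by have := alb j; lra.
Qed.

(* [bsum ps g] is E g(S) for S a sum of independent Bernoulli variables with
   parameters [ps]. *)
Fixpoint bsum {R : realType} (ps : seq R) (g : nat -> R) : R :=
  if ps is p :: ps' then p * bsum ps' (fun x => g x.+1) + (1 - p) * bsum ps' g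
  else g 0%N.

Section BernoulliSums.
Context {R : realType}.
Implicit Types (ps : seq R) (p q : R) (g : nat -> R).

Lemma eq_bsum ps g h : (forall x, (x <= size ps)%N -> g x = h x) ->
  bsum ps g = bsum ps h.
Proof.
elim: ps g h => [|p ps IH] g h gh /=; first exact: gh.
by congr (_ * _ + _ * _); apply: IH => x xs; apply: gh => //=; exact: leqW.
Qed.

Lemma bsumZD ps (a : R) g h :
  bsum ps (fun x => a * g x + h x) = a * bsum ps g + bsum ps h.
Proof. by elim: ps g h => [|p ps IH] g h //=; rewrite !IH; ring. Qed.

Lemma bsumD ps g h : bsum ps (fun x => g x + h x) = bsum ps g + bsum ps h.
Proof. by rewrite -[bsum ps g]mul1r -bsumZD; apply: eq_bsum => x _; rewrite mul1r. Qed.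

Lemma bsumB ps g h : bsum ps (fun x => g x - h x) = bsum ps g - bsum ps h.
Proof.
by rewrite addrC -mulN1r -bsumZD; apply: eq_bsum => x _; rewrite addrC mulN1r.
Qed.

Lemma bsum_cst ps (a : R) : bsum ps (fun=> a) = a.
Proof. by elim: ps => [|p ps IH] //=; rewrite IH; ring. Qed.

Lemma bsumZ ps (a : R) g : bsum ps (fun x => a * g x) = a * bsum ps g.
Proof.
rewrite -[RHS]addr0 -[in RHS](bsum_cst ps 0) -bsumZD.
by apply: eq_bsum => x _; rewrite addr0.
Qed.

Lemma bsum_sum ps (J : Type) (r : seq J) (F : J -> nat -> R) :
  bsum ps (fun x => \sum_(j <- r) F j x) = \sum_(j <- r) bsum ps (F j).
Proof.
elim: r => [|j r IH].
  by under eq_bsum => x _ do rewrite big_nil; rewrite bsum_cst big_nil.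
by under eq_bsum => x _ do rewrite big_cons; rewrite bsumD IH big_cons.
Qed.

Lemma le_bsum ps g h : {in ps, forall p, 0 <= p <= 1} ->
  (forall x, g x <= h x) -> bsum ps g <= bsum ps h.
Proof.
elim: ps g h => [|p ps IH] g h psP gh /=; first exact: gh.
have /andP[p0 p1] := psP p (mem_head _ _).
have {}psP : {in ps, forall p, 0 <= p <= 1}.
  by move=> e eps; apply: psP; rewrite in_cons eps orbT.
by apply: lerD; apply: ler_wpM2l; rewrite ?subr_ge0//; apply: IH => //= x; exact: gh.
Qed.

(** Variance plus squared bias. The centre is arbitrary because a success of the first variable
    shifts it to [c - 1] in the induction. *)
Lemma bsum_sqr_shift ps (c : R) :
  bsum ps (fun x => (x%:R - c) ^+ 2) =
  \sum_(p <- ps) p * (1 - p) + (\sum_(p <- ps) p - c) ^+ 2.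
Proof.
elim: ps c => [|p ps IH] c /=; first by rewrite !big_nil; ring.
rewrite (@eq_bsum ps _ (fun x => (x%:R - (c - 1)) ^+ 2)); last first.
  by move=> x _; rewrite -natr1; ring.
by rewrite !big_cons !IH; ring.
Qed.

(** Conditioning on all the other variables leaves one Bernoulli, whose parameter multiplies the
    increment of [g]. *)
Lemma bsum_swap ps1 ps2 p q g :
  bsum (ps1 ++ p :: ps2) g - bsum (ps1 ++ q :: ps2) g =
  (p - q) * bsum (ps1 ++ ps2) (fun x => g x.+1 - g x).
Proof.
elim: ps1 g => [|r ps IH] g /=; first by rewrite bsumB; ring.
rewrite (_ : forall a b c d, r * a + (1 - r) * b - (r * c + (1 - r) * d) =
  r * (a - c) + (1 - r) * (b - d)); last by move=> *; ring.
by rewrite 2!IH; ring.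
Qed.

Lemma expect_count (I : finType) (ds : seq (I -> R)) (i : I) g :
  {in ds, forall d, prob_vec d} ->
  expect ds (fun s => g (count_mem i s)) = bsum [seq d i | d <- ds] g.
Proof.
elim: ds g => [|d ds IH] g dsP //=.
have dP : prob_vec d by apply: dsP; exact: mem_head.
have {}dsP : {in ds, forall d, prob_vec d}.
  by move=> e eds; apply: dsP; rewrite in_cons eds orbT.
rewrite (bigD1 i)//= eqxx -!IH//; congr (_ + _).
have -> : 1 - d i = \sum_(j | j != i) d j.
  by rewrite -(proj2 dP) (bigD1 i)//= addrAC subrr add0r.
by rewrite mulr_suml; apply: eq_bigr => j /negPf ->.
Qed.

(* Replacing the parameters [p] of a binomial variable by [q] one at a time
   writes the difference of two binomial tails as
   P(X > t) - P(Y > t) = (p - q) * hybrid_mass p q k t. *)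
Definition hybrid (p q : R) (k : nat) (j : 'I_k) : seq R :=
  nseq j p ++ nseq (k - j.+1) q.

Definition hybrid_mass (p q : R) (k t : nat) : R :=
  \sum_(j < k) bsum (hybrid p q k j) (fun x => (x == t)%:R).

Lemma binomial_tailB p q k t :
  bsum (nseq k p) (fun x => (t < x)%N%:R) - bsum (nseq k q) (fun x => (t < x)%N%:R) =
  (p - q) * hybrid_mass p q k t.
Proof.
(* [u] interpolates between all parameters [q] at [0] and all parameters [p] at [k]. *)
pose u j := bsum (nseq j p ++ nseq (k - j) q) (fun x => (t < x)%N%:R).
have -> : bsum (nseq k p) (fun x => (t < x)%N%:R) = u k.
  by rewrite /u subnn cats0.
have -> : bsum (nseq k q) (fun x => (t < x)%N%:R) = u 0%N by rewrite /u subn0.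
rewrite -telescope_sumr// big_mkord mulr_sumr; apply: eq_bigr => j _.
rewrite /u -[in nseq (k - j)](@subnSK j k)// -addn1 nseqD -catA /= bsum_swap.
(* The increment of the indicator of [t < x] is the indicator of [x == t]. *)
rewrite addn1; congr (_ * _); apply: eq_bsum => x _; rewrite ltnS.
by case: ltngtP; rewrite ?subrr ?subr0.
Qed.

Lemma size_hybrid p q k j : size (hybrid p q k j) = k.-1.
Proof. by rewrite size_cat !size_nseq; case: j => j /=; lia. Qed.

Lemma sum_hybrid p q k j (F : R -> R) :
  \sum_(r <- hybrid p q k j) F r = j%:R * F p + (k - j.+1)%:R * F q.
Proof. by rewrite big_cat /= !big_nseq !iter_addr_0 !mulr_natl. Qed.

Lemma hybrid01 p q k j : 0 <= p <= 1 -> 0 <= q <= 1 ->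
  {in hybrid p q k j, forall r, 0 <= r <= 1}.
Proof.
move=> p01 q01 r; rewrite mem_cat => /orP[] /nseqP[-> _] //.
Qed.

Lemma hybrid_mass_ge0 p q k t : 0 <= p <= 1 -> 0 <= q <= 1 ->
  0 <= hybrid_mass p q k t.
Proof.
move=> p01 q01; apply: sumr_ge0 => j _.
rewrite -[leLHS](bsum_cst (hybrid p q k j)); apply: le_bsum => //.
exact: hybrid01.
Qed.

(** A hybrid has [k.-1] parameters, so its sum stays below [k] and the thresholds [t < k] see all of
    its mass. *)
Lemma sum_hybrid_mass p q k (w : nat -> R) :
  \sum_(t < k) w t * hybrid_mass p q k t = \sum_(j < k) bsum (hybrid p q k j) w.
Proof.
under eq_bigr => t _ do rewrite mulr_sumr.
rewrite exchange_big; apply: eq_bigr => j _ /=.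
under eq_bigr => t _ do rewrite -bsumZ.
rewrite -bsum_sum; apply: eq_bsum => x; rewrite size_hybrid => xk.
have {}xk : (x < k)%N by case: (k) j xk => [[]|] //.
rewrite (bigD1 (Ordinal xk))//= eqxx mulr1 big1 ?addr0// => t /eqP tx.
case: eqP => [xt|]; last by rewrite mulr0.
by case: tx; apply: val_inj.
Qed.

(** In each square, one factor is a difference of two probabilities, at most 1 in absolute value;
    the masses in the other factor add up to [k]. *)
Lemma binomial_tail_dist p q k :
  0 <= p <= 1 -> 0 <= q <= 1 ->
  \sum_(t < k) ((p - q) * hybrid_mass p q k t) ^+ 2 <= k%:R * `|p - q|.
Proof.
move=> p01 q01.
have <- : \sum_(t < k) 1 * hybrid_mass p q k t = k%:R.
  rewrite (sum_hybrid_mass p q k (fun=> 1)); under eq_bigr => j _ do rewrite bsum_cst.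
  by rewrite sumr_const card_ord.
rewrite mulr_suml; apply: ler_sum => t _.
have H0 := hybrid_mass_ge0 p q k t p01 q01.
rewrite -[leLHS]real_normK ?num_real// normrM (ger0_norm H0) mul1r expr2.
rewrite -[leRHS]mul1r [leRHS]mulrA -[leRHS]mulrA [_ * `|p - q|]mulrC.
apply: ler_wpM2r; first by rewrite mulr_ge0.
rewrite -[hybrid_mass _ _ _ _]ger0_norm// -normrM -binomial_tailB.
have tail01 (r : R) : 0 <= r <= 1 ->
    0 <= bsum (nseq k r) (fun x => (t < x)%N%:R) <= 1.
  move=> r01; have rP : {in nseq k r, forall r, 0 <= r <= 1}.
    by move=> r' /nseqP[->].
  rewrite -[X in X <= _](bsum_cst (nseq k r)) -[X in _ && (_ <= X)](bsum_cst (nseq k r)).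
  by apply/andP; split; apply: le_bsum => // x; case: (_ < _)%N.
by have := tail01 _ p01; have := tail01 _ q01; rewrite ler_norml; lra.
Qed.

Lemma card_window k (lo hi : R) :
  lo <= hi -> \sum_(t < k) (lo <= t%:R <= hi)%R%:R <= hi - lo + 1.
Proof.
move=> lohi; pose S m : R := \sum_(t < m) (lo <= t%:R <= hi)%R%:R.
(* The disjunction strengthens the induction: [k%:R - lo] may be negative as long as nothing has
   been counted. *)
suff [] : S k <= hi - lo + 1 /\ (S k = 0 \/ S k <= k%:R - lo) by [].
elim: k => [|k [IH1 IH2]].
  by rewrite /S big_ord0; split; [lra|left].
rewrite /S big_ord_recr /= -/(S k) -natr1.
case: (boolP (_ <= _ <= _)) => [/andP[lok khi]|_]; last first.
  by rewrite addr0; split=> //; case: IH2; [left|right; lra].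
by rewrite mulr1n; split; [|right]; case: IH2; lra.
Qed.

(* Chebyshev's inequality puts half of the mass of every hybrid into a window of
   radius [r] around [k(p+q)/2], and Cauchy-Schwarz is applied on that window. *)
Lemma sqr_binomial_tail_dist p q k : 0 <= p <= 1 -> 0 <= q <= 1 ->
  (k%:R * `|p - q|) ^+ 2 <=
  4 * (4 * Num.sqrt (k%:R * (p + q)) + 2 * (k%:R * `|p - q|) + 5) *
  \sum_(t < k) ((p - q) * hybrid_mass p q k t) ^+ 2.
Proof.
move=> p01 q01; set s := k%:R * (p + q); set d := k%:R * `|p - q|.
have s0 : 0 <= s by rewrite mulr_ge0//; lra.
have d0 : 0 <= d by rewrite mulr_ge0.
set x := Num.sqrt s; have x0 : 0 <= x by exact: sqrtr_ge0.
have x2 : x ^+ 2 = s by rewrite sqr_sqrtr.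
(* A hybrid has variance at most [x ^+ 2] and mean within [d / 2 + 1] of [c]; [r] is twice the sum
   of [x] and [d / 2 + 1], so at most a quarter of the mass lies outside the window. *)
set c : R := s / 2; set r := 2 * x + d + 2.
have r0 : 0 < r by rewrite /r; lra.
have r20 : 0 < r ^+ 2 by rewrite exprn_gt0.
pose w (t : nat) : R := (c - r <= t%:R <= c + r)%R%:R.
have wge t : 1 - (t%:R - c) ^+ 2 / r ^+ 2 <= w t.
  rewrite /w; case: (boolP (_ <= _ <= _)) => tc.
    by rewrite gerBl divr_ge0 ?sqr_ge0// ltW.
  rewrite subr_le0 ler_pdivlMr// mul1r -[leRHS]real_normK ?num_real//.
  rewrite ler_sqr ?nnegrE//; last exact: ltW.
  move: tc; rewrite negb_and -!ltNge ler_normr; lra.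
have wmass j : 1 / 2 <= bsum (hybrid p q k j) w.
  have hP := hybrid01 p q k j p01 q01.
  apply: (@le_trans _ _ (bsum (hybrid p q k j)
      (fun t => 1 - (r ^+ 2)^-1 * (t%:R - c) ^+ 2))); last first.
    by apply: le_bsum => // t; rewrite mulrC.
  rewrite bsumB bsum_cst bsumZ bsum_sqr_shift.
  have Jk : (j < k)%N by [].
  have JMk : j%:R + (k - j.+1)%:R + 1 = k%:R :> R by rewrite -addrA natr1 subnSK// -natrD subnKC// ltnW.
  rewrite !sum_hybrid.
  set J : R := j%:R in JMk *; set M : R := (k - j.+1)%:R in JMk *.
  have J0 : 0 <= J by []. have M0 : 0 <= M by [].
  have dev : `|J * p + M * q - c| <= d / 2 + 1.
    (* The first term comes from the unequal numbers of [p] and [q], the second from the one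
       parameter missing from the hybrid. *)
    have -> : J * p + M * q - c = (J - M) / 2 * (p - q) - (p + q) / 2.
      by rewrite /c /s -JMk; field.
    apply: le_trans (ler_normB _ _) _; apply: lerD.
      by rewrite normrM /d [leRHS]mulrAC ler_wpM2r// ler_norml -JMk; lra.
    by rewrite ler_norml; lra.
  have var : J * (p * (1 - p)) + M * (q * (1 - q)) <= s.
    by rewrite /s -JMk; nra.
  have V : (J * p + M * q - c) ^+ 2 <= (d / 2 + 1) ^+ 2.
    by rewrite -[leLHS]real_normK ?num_real// ler_sqr ?nnegrE//; lra.
  rewrite lerBrDr -lerBrDl ler_pdivrMl// /r; nra.
(* The factor [p - q] does not depend on [t], so nothing cancels: each of the [k] hybrids
   contributes at least half of [p - q]. *)
have mass : d / 2 <= `|\sum_(t < k) w t * ((p - q) * hybrid_mass p q k t)|.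
  under eq_bigr => t _ do rewrite mulrCA.
  rewrite -mulr_sumr sum_hybrid_mass normrM /d mulrAC mulrC ler_wpM2l//.
  apply: le_trans (ler_norm _).
  have -> : k%:R / 2 = \sum_(j < k) (1 / 2) :> R.
    by rewrite sumr_const card_ord -mulr_natl; lra.
  by apply: ler_sum => j _.
have w0 t : 0 <= w t by rewrite /w.
have wsum : \sum_(t < k) w t <= 4 * x + 2 * d + 5.
  apply: le_trans (card_window _ _ _ _) _; rewrite /r; lra.
have cs : (\sum_(t < k) w t * ((p - q) * hybrid_mass p q k t)) ^+ 2 <=
    (\sum_(t < k) w t) * \sum_(t < k) ((p - q) * hybrid_mass p q k t) ^+ 2.
  apply: sqr_sum_le => // [t|t]; first exact: sqr_ge0.
  (* The weights are 0 or 1, hence equal to their squares. *)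
  rewrite exprMn /w; case: (_ <= _ <= _); first by rewrite expr1n.
  by rewrite mulr0n expr0n !mul0r.
have: (d / 2) ^+ 2 <= (4 * x + 2 * d + 5) *
    \sum_(t < k) ((p - q) * hybrid_mass p q k t) ^+ 2.
  apply: le_trans (le_trans cs _); last first.
    by apply: ler_wpM2r => //; apply: sumr_ge0 => t _; exact: sqr_ge0.
  by rewrite -[leRHS]real_normK ?num_real// ler_sqr ?nnegrE//; lra.
lra.
Qed.

End BernoulliSums.

(** * The statistic *)

Section Statistic.
Context {R : realType} {I : finType}.
Implicit Types (i : I) (k t : nat) (s u : seq I) (p q : I -> R).

Definition exceeds i t s : R := (t < count_mem i s)%N%:R.

(* [u] consists of four blocks of [k] samples: two from [p], then two from [q].
   The pairing makes the two factors independent with the same expectation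
   P(X_i > t) - P(Y_i > t). *)
Definition block k j u := take k (drop (j * k) u).

Definition tail_stat k u : R := \sum_i \sum_(t < k)
  (exceeds i t (block k 0 u) - exceeds i t (block k 2 u)) *
  (exceeds i t (block k 1 u) - exceeds i t (block k 3 u)).

Lemma count_block_change i k l s1 x y s2 :
  (count_mem i (take k (drop l (s1 ++ x :: s2))) <=
   count_mem i (take k (drop l (s1 ++ y :: s2))) + (x == i))%N.
Proof.
elim: s1 k l => [|z s1 IH] [|k] [|l] //=; rewrite ?take0 ?drop0 //.
- lia.
- exact: leq_addr.
by rewrite -addnA leq_add2l; have := IH k 0%N; rewrite !drop0.
Qed.

Lemma sum_ind_lt k (x : nat) : \sum_(t < k) (t < x)%N%:R = (minn x k)%:R :> R.
Proof.
rewrite -natr_sum; congr _%:R; elim: k => [|k IH]; first by rewrite big_ord0 minn0.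
by rewrite big_ord_recr /= IH; lia.
Qed.

(** The indicators are monotone in the count, so for [x <= y] the absolute values drop and the sum
    is the difference of the counts truncated at [k]. *)
Lemma sum_ind_lt_dist k (x y a b : nat) : (x <= y + a)%N -> (y <= x + b)%N ->
  \sum_(t < k) `|(t < x)%N%:R - (t < y)%N%:R| <= a%:R + b%:R :> R.
Proof.
wlog xy : x y a b / (x <= y)%N.
  move=> H xya yxb; have [xy|/ltnW yx] := leqP x y; first exact: H.
  by under eq_bigr => t _ do rewrite distrC; rewrite addrC; apply: H.
move=> _ yxb; apply: (@le_trans _ _ (\sum_(t < k) ((t < y)%N%:R - (t < x)%N%:R))).
  apply: ler_sum => t _; rewrite distrC ger0_norm// subr_ge0 ler_nat.
  by case: (ltnP t x) => // tx; rewrite (leq_trans tx xy).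
by rewrite sumrB !sum_ind_lt -natrD lerBlDr -natrD ler_nat; lia.
Qed.

Lemma exceeds_block_change i k j s1 x y s2 :
  \sum_(t < k) `|exceeds i t (block k j (s1 ++ x :: s2)) -
                 exceeds i t (block k j (s1 ++ y :: s2))| <=
  (x == i)%:R + (y == i)%:R.
Proof. by apply: sum_ind_lt_dist; exact: count_block_change. Qed.

(** Only the symbols [x] and [y] are affected. Charging each of them a unit change in all four
    blocks, with the cofactors in [[-1, 1]], gives 8. *)
Lemma tail_stat_bounded_diff k s1 x y s2 :
  `|tail_stat k (s1 ++ x :: s2) - tail_stat k (s1 ++ y :: s2)| <= 8.
Proof.
rewrite /tail_stat -sumrB; apply: le_trans (ler_norm_sum _ _ _) _.
have -> : 8 = \sum_i 4 * ((x == i)%:R + (y == i)%:R) :> R.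
  rewrite -mulr_sumr big_split /= (bigD1 x)//= eqxx big1; last first.
    by move=> i /negPf; rewrite eq_sym => ->.
  rewrite (bigD1 y)//= eqxx big1; last by move=> i /negPf; rewrite eq_sym => ->.
  by rewrite !mulr1n; ring.
apply: ler_sum => i _; rewrite -sumrB; apply: le_trans (ler_norm_sum _ _ _) _.
set e := fun j t s => exceeds i t (block k j s).
apply: (@le_trans _ _ (\sum_(j < 4) \sum_(t < k)
    `|e j t (s1 ++ x :: s2) - e j t (s1 ++ y :: s2)|)); last first.
  apply: (@le_trans _ _ (\sum_(j < 4) ((x == i)%:R + (y == i)%:R))).
    by apply: ler_sum => j _; exact: exceeds_block_change.
  by rewrite sumr_const card_ord mulr_natl.
rewrite exchange_big /=; apply: ler_sum => t _; rewrite !big_ord_recl big_ord0 /=.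
have e01 j s : 0 <= e j t s <= 1 by rewrite /e /exceeds; rewrite ler0n lern1; case: (_ < _)%N.
rewrite /bump /= -!/(e _ _ _) !add1n.
set u := s1 ++ _; set v := s1 ++ _.
have := e01 0%N u; have := e01 1%N u; have := e01 2%N u; have := e01 3%N u.
have := e01 0%N v; have := e01 1%N v; have := e01 2%N v; have := e01 3%N v.
move: (e 0%N t u) (e 1%N t u) (e 2%N t u) (e 3%N t u) (e 0%N t v) (e 1%N t v) (e 2%N t v) (e 3%N t v).
move=> a0 a1 a2 a3 b0 b1 b2 b3 ? ? ? ? ? ? ? ?.
have -> : (a0 - a2) * (a1 - a3) - (b0 - b2) * (b1 - b3) =
  (a0 - b0 - (a2 - b2)) * (a1 - a3) + (b0 - b2) * (a1 - b1 - (a3 - b3)) by ring.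
apply: le_trans (ler_normD _ _) _; rewrite !normrM.
have A : `|a1 - a3| <= 1 by rewrite ler_norml; lra.
have B : `|b0 - b2| <= 1 by rewrite ler_norml; lra.
have C := ler_normB (a0 - b0) (a2 - b2); have D := ler_normB (a1 - b1) (a3 - b3).
have E : `|a0 - b0 - (a2 - b2)| * `|a1 - a3| <= `|a0 - b0 - (a2 - b2)|.
  by rewrite ler_piMr.
have F : `|b0 - b2| * `|a1 - b1 - (a3 - b3)| <= `|a1 - b1 - (a3 - b3)|.
  by rewrite ler_piMl.
lra.
Qed.

Lemma block_cat4 k s0 s1 s2 s3 :
  size s0 = k -> size s1 = k -> size s2 = k -> size s3 = k ->
  [/\ block k 0 (s0 ++ s1 ++ s2 ++ s3) = s0, block k 1 (s0 ++ s1 ++ s2 ++ s3) = s1,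
      block k 2 (s0 ++ s1 ++ s2 ++ s3) = s2 & block k 3 (s0 ++ s1 ++ s2 ++ s3) = s3].
Proof.
move=> z0 z1 z2 z3; split; rewrite /block.
- by rewrite drop0 take_size_cat.
- by rewrite mul1n drop_size_cat// take_size_cat.
- by rewrite catA drop_size_cat ?size_cat ?take_size_cat//; lia.
- by rewrite catA catA drop_size_cat ?size_cat ?take_oversize//; lia.
Qed.

(** The four blocks are independent: integrating them out from the last to the first turns the
    product into the square of the tail difference. *)
Lemma expect_tail_stat k p q : prob_vec p -> prob_vec q ->
  expect (nseq (k + k) p ++ nseq (k + k) q) (tail_stat k) =
  \sum_i \sum_(t < k) ((p i - q i) * hybrid_mass (p i) (q i) k t) ^+ 2.
Proof.
move=> pP qP; rewrite /tail_stat expect_sum; apply: eq_bigr => i _.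
rewrite expect_sum; apply: eq_bigr => t _; rewrite -binomial_tailB.
have cst (d : I -> R) a : prob_vec d -> expect (nseq k d) (fun=> a) = a.
  by move=> dP; rewrite expect_cst// => d' /nseqP[->].
have tailE (d : I -> R) : prob_vec d -> expect (nseq k d) (exceeds i t) =
    bsum (nseq k (d i)) (fun x => (t < x)%N%:R).
  move=> dP; have <- : [seq e i | e <- nseq k d] = nseq k (d i) by rewrite map_nseq.
  by rewrite -expect_count// => d' /nseqP[->].
rewrite -!tailE// !nseqD -catA !expect_cat.
pose P := expect (nseq k p) (exceeds i t); pose Q := expect (nseq k q) (exceeds i t).
transitivity (expect (nseq k p) (fun s0 => expect (nseq k p) (fun s1 =>
   expect (nseq k q) (fun s2 => expect (nseq k q) (fun s3 =>
   (exceeds i t s0 - exceeds i t s2) * (exceeds i t s1 - exceeds i t s3)))))).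
  apply: eq_expect => s0 z0; rewrite expect_cat.
  apply: eq_expect => s1 z1; rewrite expect_cat.
  apply: eq_expect => s2 z2; apply: eq_expect => s3 z3.
  move: z0 z1 z2 z3; rewrite !size_nseq => z0 z1 z2 z3.
  by have [-> -> -> ->] := block_cat4 k s0 s1 s2 s3 z0 z1 z2 z3.
transitivity (expect (nseq k p) (fun s0 => expect (nseq k p) (fun s1 =>
   (exceeds i t s0 - Q) * (exceeds i t s1 - Q)))).
  apply: eq_expect => s0 _; apply: eq_expect => s1 _.
  transitivity (expect (nseq k q) (fun s2 =>
      (exceeds i t s0 - exceeds i t s2) * (exceeds i t s1 - Q))).
    by apply: eq_expect => s2 _; rewrite expectZ expectB (cst q).
  by rewrite expectZr expectB (cst q).
rewrite -/P -/Q expr2.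
transitivity (expect (nseq k p) (fun s0 => (exceeds i t s0 - Q) * (P - Q))).
  by apply: eq_expect => s0 _; rewrite expectZ expectB (cst p).
by rewrite expectZr expectB (cst p).
Qed.

Lemma expect_tail_stat_le k p q : prob_vec p -> prob_vec q ->
  expect (nseq (k + k) p ++ nseq (k + k) q) (tail_stat k) <=
  k%:R * \sum_i `|p i - q i|.
Proof.
move=> pP qP; rewrite expect_tail_stat// mulr_sumr; apply: ler_sum => i _.
have le1 (d : I -> R) : prob_vec d -> 0 <= d i <= 1.
  move=> [d0 d1]; rewrite d0 -d1 (bigD1 i)//= lerDl.
  by apply: sumr_ge0 => j _; exact: d0.
by apply: binomial_tail_dist; exact: le1.
Qed.

(** Cauchy-Schwarz over the symbols, with the per-symbol factors of [sqr_binomial_tail_dist] as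
    weights [l]. *)
Lemma expect_tail_stat_ge k p q : prob_vec p -> prob_vec q ->
  (k%:R * \sum_i `|p i - q i|) ^+ 2 <=
  (24 * (Num.sqrt k%:R * Num.sqrt #|I|%:R) + 8 * (k%:R * \sum_i `|p i - q i|)
     + 20 * #|I|%:R) *
  expect (nseq (k + k) p ++ nseq (k + k) q) (tail_stat k).
Proof.
move=> pP qP; rewrite expect_tail_stat// mulr_sumr.
have le1 (d : I -> R) i : prob_vec d -> 0 <= d i <= 1.
  move=> [d0 d1]; rewrite d0 -d1 (bigD1 i)//= lerDl.
  by apply: sumr_ge0 => j _; exact: d0.
have D0 i : 0 <= \sum_(t < k) ((p i - q i) * hybrid_mass (p i) (q i) k t) ^+ 2.
  by apply: sumr_ge0 => t _; exact: sqr_ge0.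
pose l i := 4 * (4 * Num.sqrt (k%:R * (p i + q i)) +
                 2 * (k%:R * `|p i - q i|) + 5).
have l0 i : 0 <= l i.
  by rewrite mulr_ge0// !addr_ge0// mulr_ge0// ?sqrtr_ge0// mulr_ge0.
apply: le_trans (sqr_sum_le _ _ l _ l0 D0 _) _.
  by move=> i; apply: sqr_binomial_tail_dist; exact: le1.
apply: ler_wpM2r; first exact: sumr_ge0.
(* A second Cauchy-Schwarz uses that [p] and [q] have total mass 2; [3 / 2] is a rational bound for
   the square root of 2, and [16 * 3 / 2 = 24]. *)
have sqrts : \sum_i Num.sqrt (k%:R * (p i + q i)) <=
    3 / 2 * (Num.sqrt k%:R * Num.sqrt #|I|%:R).
  have -> : \sum_i Num.sqrt (k%:R * (p i + q i)) =
      Num.sqrt k%:R * \sum_i Num.sqrt (p i + q i).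
    by rewrite mulr_sumr; apply: eq_bigr => i _; rewrite sqrtrM.
  rewrite mulrCA ler_wpM2l ?sqrtr_ge0//.
  rewrite -[leLHS]ger0_norm; last by apply: sumr_ge0 => i _; exact: sqrtr_ge0.
  have v0 : 0 <= Num.sqrt #|I|%:R :> R by exact: sqrtr_ge0.
  have: (\sum_i Num.sqrt (p i + q i)) ^+ 2 <= (\sum_(i : I) 1) * \sum_i (p i + q i).
    apply: sqr_sum_le => // i; have := le1 p i pP; have := le1 q i qP; first lra.
    by rewrite mul1r => ? ?; rewrite sqr_sqrtr//; lra.
  rewrite sumr_const big_split /= (proj2 pP) (proj2 qP) => h.
  rewrite -ler_sqr ?nnegrE ?mulr_ge0 ?divr_ge0//.
  rewrite real_normK ?num_real// exprMn sqr_sqrtr//.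
  apply: le_trans h _; rewrite -[1 *+ _]/(_%:R).
  have := ler0n R #|I|; lra.
have -> : \sum_i l i = 16 * (\sum_i Num.sqrt (k%:R * (p i + q i))) +
    8 * (\sum_i k%:R * `|p i - q i|) + 20 * #|I|%:R.
  have -> : 20 * #|I|%:R = \sum_(i : I) 20 :> R by rewrite sumr_const mulr_natr.
  by rewrite !mulr_sumr -!big_split /=; apply: eq_bigr => i _; rewrite /l; ring.
lra.
Qed.

End Statistic.

(** * Choice of the sample size *)

Section SampleSize.
Context {R : realType}.

Definition sample_bound (n : nat) (e1 e2 : R) : R :=
  n%:R * (e1 / e2 ^+ 2) ^+ 2 + n%:R * (e1 / e2 ^+ 2)
  + Num.sqrt n%:R / e2 ^+ 2 + powR n%:R (2 / 3) / powR e2 (4 / 3).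

(** Removes fractional powers. The first two inequalities come from the first two terms of the
    bound, the next two from the third term (with [1 <= v]), the last from the fourth. Square roots
    turn [100 ^+ 4] into [100 ^+ 2]. *)
Lemma sample_boundP (n k : nat) (e1 e2 : R) :
  (1 <= n)%N -> 0 < e2 -> e2 <= 1 -> 0 <= e1 ->
  100 ^+ 4 * sample_bound n e1 e2 <= k%:R ->
  let x := Num.sqrt k%:R in let v := Num.sqrt n%:R in
  [/\ 100 ^+ 2 * (v * e1) <= x * e2 ^+ 2,
      100 ^+ 2 * (v ^+ 2 * e1) <= x ^+ 2 * e2 ^+ 2,
      100 ^+ 2 * v <= x ^+ 2 * e2 ^+ 2,
      100 ^+ 2 <= x * e2 &
      100 ^+ 2 * v ^+ 2 <= x ^+ 3 * e2 ^+ 2].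
Proof.
move=> n1 e20 e21 e10 hk /=.
(* Only [1 <= M] is kept about the constant, so that its powers stay symbolic. *)
have [M [M1 Ms]] : exists M : R, 1 <= M /\ 100 = M by exists 100; split=> //; lra.
rewrite {}Ms in hk *; set x := Num.sqrt k%:R; set v := Num.sqrt n%:R.
have x2 : x ^+ 2 = k%:R by rewrite sqr_sqrtr.
have v2 : v ^+ 2 = n%:R by rewrite sqr_sqrtr.
have x0 : 0 <= x by exact: sqrtr_ge0.
have v1 : 1 <= v by rewrite -[leLHS]sqrtr1 ler_wsqrtr// ler1n.
have v0 : 0 <= v by exact: le_trans v1.
have e220 : 0 < e2 ^+ 2 by rewrite exprn_gt0.
pose u := e1 / e2 ^+ 2.
have u0 : 0 <= u by rewrite divr_ge0// ltW.
have e1u : e1 = u * e2 ^+ 2 by rewrite divfK// gt_eqF.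
pose N := powR n%:R (2 / 3) / powR e2 (4 / 3).
have N0 : 0 <= N by rewrite divr_ge0 ?powR_ge0.
(* Cubing clears the exponents [2 / 3] and [4 / 3]. *)
have N3 : N ^+ 3 * e2 ^+ 4 = v ^+ 4.
  have e24 : powR e2 (4 / 3) ^+ 3 = e2 ^+ 4.
    rewrite -[LHS]powR_mulrn ?powR_ge0// -powRrM -[RHS]powR_mulrn ?ltW//; congr powR; lra.
  have n2 : powR n%:R (2 / 3) ^+ 3 = n%:R ^+ 2 :> R.
    rewrite -[LHS]powR_mulrn ?powR_ge0// -powRrM -[RHS]powR_mulrn//; congr powR; lra.
  rewrite /N exprMn exprVn e24 n2 divfK ?gt_eqF ?exprn_gt0// -v2; ring.
have M0 : 0 <= M by exact: le_trans M1.
have e2ge0 := ltW e20.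
have M2 : 1 <= M ^+ 2 by rewrite exprn_ege1.
have M4 : M ^+ 2 <= M ^+ 4.
  by rewrite (_ : M ^+ 4 = M ^+ 2 * M ^+ 2) ?ler_peMr// ?(le_trans _ M2)//; ring.
have M4ge1 : 1 <= M ^+ 4 by exact: le_trans M4.
have M40 : 0 <= M ^+ 4 by exact: le_trans M4ge1.
have t1 : 0 <= M ^+ 4 * (v ^+ 2 * u ^+ 2) by rewrite mulr_ge0// mulr_ge0 ?sqr_ge0.
have t2 : 0 <= M ^+ 4 * (v ^+ 2 * u) by rewrite mulr_ge0// mulr_ge0 ?sqr_ge0.
have t3 : 0 <= M ^+ 4 * (v / e2 ^+ 2).
  by rewrite mulr_ge0// divr_ge0// ?ltW//; lra.
have t4 : 0 <= M ^+ 4 * N by rewrite mulr_ge0.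
have hx : M ^+ 4 * (v ^+ 2 * u ^+ 2) + M ^+ 4 * (v ^+ 2 * u)
    + M ^+ 4 * (v / e2 ^+ 2) + M ^+ 4 * N <= x ^+ 2.
  by move: hk; rewrite /sample_bound -/u -/v -/N -v2 -x2; lra.
clearbody u N.
have h3 : M ^+ 4 * v <= x ^+ 2 * e2 ^+ 2.
  by rewrite -ler_pdivrMr// -mulrA; lra.
split.
- rewrite (_ : _ * (v * _) = M ^+ 2 * (v * u) * e2 ^+ 2); last by rewrite e1u; ring.
  rewrite ler_pM2r// -ler_sqr ?nnegrE ?mulr_ge0 ?sqr_ge0//.
  by rewrite (_ : (_ * _) ^+ 2 = M ^+ 4 * (v ^+ 2 * u ^+ 2)); [lra|ring].
- rewrite (_ : _ * (_ * e1) = M ^+ 2 * (v ^+ 2 * u) * e2 ^+ 2); last by rewrite e1u; ring.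
  rewrite ler_pM2r//.
  by apply: (@le_trans _ _ (M ^+ 4 * (v ^+ 2 * u))); [rewrite ler_wpM2r// mulr_ge0 ?sqr_ge0|lra].
- by apply: le_trans h3; rewrite ler_wpM2r//; lra.
- rewrite -ler_sqr ?nnegrE ?mulr_ge0 ?sqr_ge0// [leRHS]exprMn.
  apply: le_trans h3; rewrite (_ : (M ^+ 2) ^+ 2 = M ^+ 4 * 1); last by ring.
  by rewrite ler_wpM2l.
- rewrite -ler_sqr ?nnegrE ?mulr_ge0 ?sqr_ge0 ?exprn_ge0//.
  rewrite (_ : (M ^+ 2 * _) ^+ 2 = M ^+ 4 * v ^+ 4); last by ring.
  apply: (@le_trans _ _ ((M ^+ 4 * N) ^+ 3 * e2 ^+ 4)).
    rewrite -N3 exprMn mulrA ler_wpM2r ?exprn_ge0//.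
    by rewrite ler_wpM2r ?exprn_ge0// ler_eXnr.
  rewrite (_ : (x ^+ 3 * e2 ^+ 2) ^+ 2 = (x ^+ 2) ^+ 3 * e2 ^+ 4); last by ring.
  rewrite ler_wpM2r ?exprn_ge0// lerXn2r ?nnegrE ?sqr_ge0//; lra.
Qed.

(* [G] below is the guaranteed expectation of the statistic when the distance is
   at least [e2]; the tester thresholds at [G / 2]. *)
Lemma expectation_gap (x v e1 e2 : R) (a := 24 * (x * v) + 20 * v ^+ 2)
    (G := (x ^+ 2 * e2) ^+ 2 / (a + 8 * (x ^+ 2 * e2))) :
  0 < x -> 0 < v -> 0 < e2 -> e1 <= 1 / 96 * e2 ->
  100 ^+ 2 * (v * e1) <= x * e2 ^+ 2 ->
  100 ^+ 2 * (v ^+ 2 * e1) <= x ^+ 2 * e2 ^+ 2 ->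
  100 ^+ 2 * v <= x ^+ 2 * e2 ^+ 2 ->
  100 ^+ 2 <= x * e2 ->
  100 ^+ 2 * v ^+ 2 <= x ^+ 3 * e2 ^+ 2 ->
  x ^+ 2 * e1 <= G / 4 /\ 144 * x <= G.
Proof.
move=> x0 v0 e20 e1c h1 h2 h3 h5 h4; rewrite /G.
have a0 : 0 < a by rewrite addr_gt0 ?mulr_gt0 ?exprn_gt0.
have z0 : 0 < x ^+ 2 * e2 by rewrite mulr_gt0 ?exprn_gt0.
have A0 : 0 < a + 8 * (x ^+ 2 * e2) by rewrite addr_gt0// mulr_gt0.
split.
  rewrite [leRHS]mulrAC ler_pdivlMr// -[leLHS]mulrA.
  rewrite (_ : (_ * e2) ^+ 2 / 4 = x ^+ 2 * (x ^+ 2 * e2 ^+ 2 / 4)); last by field.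
  rewrite ler_wpM2l ?sqr_ge0//.
  (* The three terms of [e1 * (a + 8 * (x ^+ 2 * e2))] are at most [24 / 100 ^+ 2], [20 / 100 ^+ 2]
     and [8 / 96] of [x ^+ 2 * e2 ^+ 2], in total below a quarter. *)
  have u1 : 100 ^+ 2 * (v * e1 * x) <= x ^+ 2 * e2 ^+ 2.
    by have := ler_wpM2r (ltW x0) h1; lra.
  have u3 : x ^+ 2 * e2 * e1 <= x ^+ 2 * e2 * (1 / 96 * e2).
    by rewrite ler_wpM2l// ltW.
  rewrite /a; lra.
rewrite ler_pdivlMr//.
rewrite (_ : (_ * e2) ^+ 2 = x * (x ^+ 3 * e2 ^+ 2)); last by ring.
rewrite mulrAC [leLHS]mulrC ler_wpM2l ?(ltW x0)//.
(* The constant 100 suffices because [144 * (24 + 20 + 8) <= 100 ^+ 2]. *)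
have u3 : 100 ^+ 2 * (v * x) <= x ^+ 3 * e2 ^+ 2.
  by have := ler_wpM2r (ltW x0) h3; lra.
have u5 : 100 ^+ 2 * (x ^+ 2 * e2) <= x ^+ 3 * e2 ^+ 2.
  by have := ler_wpM2r (ltW z0) h5; lra.
rewrite /a; lra.
Qed.

(** [y ^+ 2 / (a + 8 * y)] increases with [y], so a bound at the actual distance yields one at the
    smallest admissible distance. *)
Lemma sqr_div_affine_le (a y z Z : R) : 0 < a -> 0 < z -> z <= y ->
  y ^+ 2 <= (a + 8 * y) * Z -> z ^+ 2 / (a + 8 * z) <= Z.
Proof.
move=> a0 z0 zy hZ; have y0 : 0 < y by exact: lt_le_trans zy.
have az0 : 0 < a + 8 * z by rewrite addr_gt0// mulr_gt0.
have ay0 : 0 < a + 8 * y by rewrite addr_gt0// mulr_gt0.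
rewrite ler_pdivrMr// -(ler_pM2r ay0).
apply: (@le_trans _ _ (y ^+ 2 * (a + 8 * z))).
  have u1 : 0 <= a * ((y - z) * (y + z)).
    by rewrite !mulr_ge0 ?subr_ge0 ?addr_ge0 ?(ltW z0) ?(ltW y0) ?(ltW a0).
  have u2 : 0 <= z * (y * (y - z)).
    by rewrite !mulr_ge0 ?subr_ge0 ?(ltW z0) ?(ltW y0).
  lra.
by rewrite [leRHS]mulrAC ler_wpM2r ?(ltW az0)//; move: hZ; lra.
Qed.

(** The gap [G / 4] is at least [36 * x], and [256 / 36 ^+ 2] is just below [1 / 5]. *)
Lemma chebyshev_failure_le (x G : R) : 0 < x -> 144 * x <= G ->
  256 * x ^+ 2 / (G / 4) ^+ 2 <= 1 / 5.
Proof.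
move=> x0 Gx; have G0 : 0 < G by lra.
rewrite ler_pdivrMr; last by rewrite exprn_gt0// divr_gt0.
have := @lerXn2r _ 2 (144 * x) G; rewrite !nnegrE => /(_ _ _ Gx).
rewrite [(144 * x) ^+ 2]exprMn expr_div_n; have := sqr_ge0 x; lra.
Qed.

(** Lets the rounding of the sample size to an integer be absorbed in the constant. *)
Lemma sample_bound_ge1 (n : nat) (e1 e2 : R) :
  (1 <= n)%N -> 0 < e2 -> e2 <= 1 -> 0 <= e1 -> 1 <= sample_bound n e1 e2.
Proof.
move=> n1 e20 e21 e10; rewrite /sample_bound.
have a0 : 0 <= n%:R * (e1 / e2 ^+ 2) ^+ 2 by rewrite mulr_ge0 ?sqr_ge0.
have b0 : 0 <= n%:R * (e1 / e2 ^+ 2).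
  by rewrite mulr_ge0 ?divr_ge0// exprn_ge0// ltW.
have d0 : 0 <= powR n%:R (2 / 3) / powR e2 (4 / 3) by rewrite divr_ge0 ?powR_ge0.
suff : 1 <= Num.sqrt n%:R / e2 ^+ 2 by lra.
rewrite ler_pdivlMr ?exprn_gt0// mul1r (@le_trans _ _ 1)//.
  by rewrite exprn_ile1// ltW.
by rewrite -[leLHS]sqrtr1 ler_wsqrtr// ler1n.
Qed.

End SampleSize.

(** * The tester and its analysis *)

Lemma prob_vec_dist (R : realType) (n : nat) (p : {ffun 'I_n -> R}) :
  is_dist p -> prob_vec p.
Proof. by []. Qed.

Lemma accept_prob_expect (R : realType) (n m : nat) (f : seq 'I_n -> R)
    (p q : {ffun 'I_n -> R}) :
  accept_prob (fun s t : m.-tuple 'I_n => f (s ++ t)) p q =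
  expect (nseq m (p : 'I_n -> R) ++ nseq m (q : 'I_n -> R)) f.
Proof.
rewrite expect_cat -sum_sample_prob; apply: eq_bigr => s _.
rewrite -sum_sample_prob mulr_sumr.
by apply: eq_bigr => t _; rewrite mulrA.
Qed.

Theorem theorem2p2 (R : realType) :
  exists c C : R, 0 < c /\ 0 < C /\
  forall (n : nat) (eps1 eps2 : R),
    (1 <= n)%N -> 0 < eps2 -> eps2 <= 1 -> 0 <= eps1 -> eps1 <= c * eps2 ->
    exists m : nat,
      m%:R <= C * (n%:R * (eps1 / eps2 ^+ 2) ^+ 2 + n%:R * (eps1 / eps2 ^+ 2)
                   + Num.sqrt n%:R / eps2 ^+ 2
                   + powR n%:R (2 / 3) / powR eps2 (4 / 3)) /\
      exists T : m.-tuple 'I_n -> m.-tuple 'I_n -> R,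
        is_tester T /\
        forall p q : {ffun 'I_n -> R}, is_dist p -> is_dist q ->
          (l1dist p q <= eps1 -> accept_prob T p q >= 4 / 5) /\
          (l1dist p q >= eps2 -> 1 - accept_prob T p q >= 4 / 5).
Proof.
(* The factor 2 pays for two batches of [k] samples per distribution, the [+ 1] for rounding [k]
   up. *)
exists (1 / 96), (2 * (100 ^+ 4 + 1)); split; [lra|split].
  by rewrite mulr_gt0// addr_gt0// exprn_gt0.
move=> n e1 e2 n1 e20 e21 e10 e1c.
have Phi1 := sample_bound_ge1 n e1 e2 n1 e20 e21 e10.
rewrite -/(sample_bound n e1 e2).
set Phi := sample_bound n e1 e2 in Phi1 *.
have M4 : 0 <= 100 ^+ 4 :> R by rewrite exprn_ge0.
have Phi0 : 0 <= 100 ^+ 4 * Phi by apply: mulr_ge0 => //; lra.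
pose k := (Num.truncn (100 ^+ 4 * Phi)).+1.
have hk : 100 ^+ 4 * Phi <= k%:R by rewrite ltW// truncnS_gt.
have kh : k%:R <= 100 ^+ 4 * Phi + 1.
  have -> : k%:R = (Num.truncn (100 ^+ 4 * Phi))%:R + 1 :> R by rewrite natr1.
  by rewrite lerD2r; have /andP[] := truncn_itv Phi0.
exists (k + k)%N; split.
  rewrite natrD mulrAC; have : 2 * k%:R <= 2 * (100 ^+ 4 * Phi + Phi) by lra.
  by move: (100 ^+ 4) => M; lra.
have [] := sample_boundP n k e1 e2 n1 e20 e21 e10 hk.
set x := Num.sqrt k%:R; set v := Num.sqrt n%:R => h1 h2 h3 h5 h4.
have x2 : x ^+ 2 = k%:R by rewrite sqr_sqrtr.
have v2 : v ^+ 2 = n%:R by rewrite sqr_sqrtr.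
have x0 : 0 < x by rewrite sqrtr_gt0 ltr0n.
have v0 : 0 < v by rewrite sqrtr_gt0 ltr0n.
pose a := 24 * (x * v) + 20 * v ^+ 2.
have a0 : 0 < a by rewrite addr_gt0 ?mulr_gt0 ?exprn_gt0.
have [] := expectation_gap x v e1 e2 x0 v0 e20 e1c h1 h2 h3 h5 h4.
rewrite -/a; set G := _ / (a + _) => closeG Gx.
have err := chebyshev_failure_le x G x0 Gx.
have g0 : 0 < G / 4 by rewrite divr_gt0// (lt_le_trans _ Gx)// mulr_gt0.
pose T (s t : (k + k).-tuple 'I_n) : R := (tail_stat k (s ++ t) <= G / 2)%R%:R.
exists T; split; first by move=> s t; rewrite /T ler0n lern1 leq_b1.
move=> p q /prob_vec_dist pP /prob_vec_dist qP.
rewrite (accept_prob_expect R n _ (fun u => (tail_stat k u <= G / 2)%R%:R)).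
set ds := _ ++ _.
have dsP : {in ds, forall d, prob_vec d}.
  by move=> d; rewrite mem_cat => /orP[] /nseqP[-> _].
(* There are [4 * k] samples, each moving the statistic by at most 8, and [4 * 8 ^+ 2 = 256]. *)
have var : expect ds (fun u => (tail_stat k u - expect ds (tail_stat k)) ^+ 2)
    <= 256 * x ^+ 2.
  apply: le_trans (expect_bounded_diff ds _ 8 dsP (tail_stat_bounded_diff k)) _.
  rewrite size_cat !size_nseq !natrD x2; lra.
split=> dist.
  (* Close case: the expectation is at most [G / 4], a gap of [G / 4] below the threshold. *)
  apply: le_trans (expect_le_ind_ge ds _ _ (G / 2) (G / 4) dsP g0 var _); first by lra.
  apply: le_trans (expect_tail_stat_le k _ _ pP qP) _; rewrite -x2.
  apply: (@le_trans _ _ (x ^+ 2 * e1)); last by lra.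
  by rewrite ler_wpM2l ?sqr_ge0.
suff: expect ds (fun u => (tail_stat k u <= G / 2)%R%:R) <= 1 / 5 by lra.
apply: le_trans (expect_le_ind_le ds _ _ (G / 2) (G / 4) dsP g0 var _) err.
(* Far case: the expectation is at least [G], more than the required [G / 2 + G / 4]. *)
apply: (@le_trans _ _ G); first by lra.
have := expect_tail_stat_ge k _ _ pP qP; rewrite card_ord -x2 -v2.
rewrite sqrtr_sqr sqrtr_sqr !gtr0_norm//.
rewrite -/(l1dist p q) -/ds.
set y := x ^+ 2 * _; set Z := expect _ _ => hZ.
apply: (@sqr_div_affine_le _ a y) => //.
- by rewrite mulr_gt0 ?exprn_gt0.
- by rewrite ler_wpM2l ?sqr_ge0.
- by move: hZ; rewrite /a; lra.
Qed.
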